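(* Let $L$ be a BCF join-semidistributive lattice with zero. Then $\mathrm{Dim}\,L$ is (isomorphic to) the commutative monoid defined by generators $\overline{p}$, for $p\in\mathrm{J}(L)$, and relations $\overline{p}\ll\overline{q}$ for all $p,q\in\mathrm{J}(L)$ such that $p\mathbin{D}q$. Likewise, $\mathrm{Dim}\,L$ is (isomorphic to) the commutative monoid defined by generators $\overline{p}$, for $p\in\mathrm{J}(L)$, and relations $\overline{p}\ll\overline{q}$ for all $p,q\in\mathrm{J}(L)$ such that $p\vartriangleleft q$.
   Context: A partially ordered set is BCF if every bounded chain in it is finite. A lattice $L$ is join-semidistributive if $x\vee y=x\vee z$ implies $x\vee y=x\vee(y\wedge z)$ for all $x,y,z\in L$. The dimension monoid $\mathrm{Dim}\,L$ of a lattice $L$ is the commutative monoid (with zero element $0$) defined by generators $\Delta(x,y)$, for $x\le y$ in $L$, and relations: $\Delta(x,x)=0$; $\Delta(x,z)=\Delta(x,y)+\Delta(y,z)$ for $x\le y\le z$; $\Delta(x\wedge y,x)=\Delta(y,x\vee y)$, for all $x,y,z\in L$. In a commutative monoid, $x\ll y$ means $x+y=y$. $\mathrm{J}(L)$ is the set of join-irreducible elements of $L$, i.e., the nonzero elements $p$ such that $p=x\vee y$ implies $p=x$ or $p=y$. Join-dependency relation: for $a\in L$ and $q\in\mathrm{J}(L)$, $a\mathbin{D}q$ means that $a\neq q$ and there exists $x\in L$ such that $a\le q\vee x$ while $a\nleq y\vee x$ for all $y<q$. $\vartriangleleft$ denotes the transitive closure of $D$ on $\mathrm{J}(L)$. 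*)

(* Defs.v *)
From HB Require Import structures.
From Stdlib Require Import Relation_Operators.
From mathcomp Require Import all_boot all_order ssralg generic_quotient.
From mathcomp Require Import finmap multiset.
From mathcomp Require Import boolp classical_sets functions cardinality.

Set Implicit Arguments.
Unset Strict Implicit.
Unset Printing Implicit Defensive.

Import Order.TTheory GRing.Theory.

Local Open Scope mset_scope.
Local Open Scope classical_set_scope.
Local Open Scope order_scope.

(* {mset G}, under the sum of multisets, is the free commutative monoid on G. *)
HB.instance Definition _ (G : choiceType) :=
  Choice.copy {mset G} {fsfun G -> nat with 0}.
HB.instance Definition _ (G : choiceType) :=
  GRing.isNmodule.Build {mset G} (@msetDA G) (@msetDC G) (@mset0D G).

Definition mgen (G : choiceType) (g : G) : {mset G} := [mset g]%mset.

(* Commutative monoids (written additively, as nmodTypes) defined by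
   generators G and relations u = v, for all u, v such that R u v. *)
Section Presentation.
Variables (G : choiceType) (R : {mset G} -> {mset G} -> Prop).

Inductive congr_gen : {mset G} -> {mset G} -> Prop :=
| congr_rel u v : R u v -> congr_gen u v
| congr_refl u : congr_gen u u
| congr_sym u v : congr_gen u v -> congr_gen v u
| congr_trans u v w : congr_gen u v -> congr_gen v w -> congr_gen u w
| congr_add u v w : congr_gen u v -> congr_gen (u + w)%R (v + w)%R.

Definition congr_genb : rel {mset G} := fun u v => `[< congr_gen u v >].

Lemma congr_genb_refl : reflexive congr_genb.
Proof. by move=> u; apply/asboolP; apply: congr_refl. Qed.

Lemma congr_genb_sym : symmetric congr_genb.
Proof. by move=> u v; apply/asboolP/asboolP; apply: congr_sym. Qed.

Lemma congr_genb_trans : transitive congr_genb.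
Proof.
by move=> v u w /asboolP uv /asboolP vw; apply/asboolP; apply: congr_trans vw.
Qed.

Canonical congr_gen_equiv :=
  EquivRel congr_genb congr_genb_refl congr_genb_sym congr_genb_trans.

Definition presented_monoid := {eq_quot congr_genb}%qT.

HB.instance Definition _ := Choice.on presented_monoid.

Definition pm_class (u : {mset G}) : presented_monoid :=
  (\pi_({eq_quot congr_genb}) u)%qT.
Definition pm_repr (a : presented_monoid) : {mset G} :=
  repr (a : {eq_quot congr_genb}%qT).

Lemma pm_reprK a : pm_class (pm_repr a) = a.
Proof. exact: (@reprK _ {eq_quot congr_genb}%qT). Qed.

Lemma pm_classP u v : pm_class u = pm_class v <-> congr_gen u v.
Proof.
split=> [/eqmodP/asboolP //|uv].
by apply/eqmodP/asboolP.
Qed.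

Definition pm_add (a b : presented_monoid) : presented_monoid :=
  pm_class (pm_repr a + pm_repr b)%R.

Lemma pm_add_class u v : pm_add (pm_class u) (pm_class v) = pm_class (u + v)%R.
Proof.
apply/pm_classP.
apply: (@congr_trans _ (u + pm_repr (pm_class v))%R).
  by apply: congr_add; apply/pm_classP; rewrite pm_reprK.
rewrite ![(u + _)%R]addrC.
by apply: congr_add; apply/pm_classP; rewrite pm_reprK.
Qed.

Lemma pm_addA : associative pm_add.
Proof.
move=> a b c; rewrite -(pm_reprK a) -(pm_reprK b) -(pm_reprK c).
by rewrite !pm_add_class addrA.
Qed.

Lemma pm_addC : commutative pm_add.
Proof. by move=> a b; rewrite /pm_add addrC. Qed.

Lemma pm_add0 : left_id (pm_class 0%R) pm_add.
Proof. by move=> a; rewrite -(pm_reprK a) pm_add_class add0r. Qed.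

HB.instance Definition _ :=
  GRing.isNmodule.Build presented_monoid pm_addA pm_addC pm_add0.

Lemma pm_classD u v : pm_class (u + v)%R = (pm_class u + pm_class v)%R.
Proof. by rewrite -pm_add_class. Qed.

Lemma pm_lift (N : nmodType) (h : G -> N) :
  (forall u v, R u v -> (\sum_(g <- u) h g = \sum_(g <- v) h g)%R) ->
  exists f : {additive presented_monoid -> N},
    forall g, f (pm_class (mgen g)) = h g.
Proof.
move=> hR.
have hD (u v : {mset G}) : (\sum_(g <- (u + v : {mset G})) h g =
               \sum_(g <- u) h g + \sum_(g <- v) h g)%R.
  rewrite -big_cat /=; apply: perm_big; apply/allP => x _ /=.
  by rewrite count_cat !count_mem_mset msetE2.
have hc (u v : {mset G}) : congr_gen u v -> (\sum_(g <- u) h g = \sum_(g <- v) h g)%R.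
  elim=> {u v} [u v /hR //|//|u v _ -> //|u v w _ -> _ -> //|u v w _ e].
  by rewrite !hD e.
pose f (a : presented_monoid) : N := (\sum_(g <- pm_repr a) h g)%R.
have fE (u : {mset G}) : f (pm_class u) = (\sum_(g <- u) h g)%R.
  by apply: hc; apply/pm_classP; rewrite pm_reprK.
have f_add : nmod_morphism f.
  split=> [|a b]; first by rewrite fE big_mset0.
  by rewrite -(pm_reprK a) -(pm_reprK b) -pm_classD !fE hD.
pose F : {additive presented_monoid -> N} :=
  HB.pack f (GRing.isNmodMorphism.Build _ _ f f_add).
by exists F => g; rewrite /F /= fE big_msetn.
Qed.

Lemma pm_lift_unique (N : nmodType) (f f' : {additive presented_monoid -> N}) :
  (forall g, f (pm_class (mgen g)) = f' (pm_class (mgen g))) -> f =1 f'.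
Proof.
move=> ff' a; rewrite -(pm_reprK a) -(seq_mset_id (pm_repr a)).
elim: (enum_mset (pm_repr a)) => [|g s IHs].
  have -> : pm_class (seq_mset [::]) = 0%R.
    by congr pm_class; apply/msetP => x; rewrite mset_seqE mset0E.
  by rewrite !raddf0.
have -> : seq_mset (g :: s) = (mgen g + seq_mset s)%R.
  by apply/msetP => x; rewrite mset1DE !mset_seqE /= eq_sym.
by rewrite pm_classD !raddfD ff' IHs.
Qed.

End Presentation.

Definition monoid_isomorphic (M N : nmodType) : Prop :=
  exists f : {additive M -> N}, bijective f.

(* "bounded chain finite" *)
Definition BCF d (P : porderType d) : Prop :=
  forall C : set P, total_on C (fun x y => x <= y) ->
    has_lbound C -> has_ubound C -> finite_set C.

Definition join_semidistributive d (L : latticeType d) : Prop :=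
  forall x y z : L, x `|` y = x `|` z -> x `|` y = x `|` (y `&` z).

Section DimensionMonoid.
Context d (L : latticeType d).

Definition interval_of := {xy : L * L | xy.1 <= xy.2}.

Definition Delta (x y : L) (xy : x <= y) : {mset interval_of} :=
  mgen (exist (fun xy : L * L => xy.1 <= xy.2) (x, y) xy).

Inductive Dim_rel : {mset interval_of} -> {mset interval_of} -> Prop :=
| Dim_rel0 (x : L) : Dim_rel (Delta (lexx x)) 0%R
| Dim_relD (x y z : L) (xy : x <= y) (yz : y <= z) :
    Dim_rel (Delta (le_trans xy yz)) (Delta xy + Delta yz)%R
| Dim_relIU (x y : L) :
    Dim_rel (Delta (leIl x y : x `&` y <= x)) (Delta (leUr y x : y <= x `|` y)).

Definition Dim : nmodType := presented_monoid Dim_rel.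

End DimensionMonoid.

Arguments Dim {d} L.

Section JoinIrreducible.
Context d (L : bLatticeType d).

Definition join_irreducible : set L :=
  [set p | p <> \bot /\ forall x y : L, p = x `|` y -> p = x \/ p = y].

Definition join_dep (a q : L) : Prop :=
  a <> q /\ exists x : L, a <= q `|` x /\ forall y : L, y < q -> ~ (a <= y `|` x).

(* D, restricted to J(L), and its transitive closure there. *)
Definition JD (p q : join_irreducible) : Prop := join_dep (val p) (val q).

Definition JD_trans : join_irreducible -> join_irreducible -> Prop :=
  clos_trans _ JD.

End JoinIrreducible.

Arguments join_irreducible {d} L.
Arguments JD {d L} p q.
Arguments JD_trans {d L} p q.

(* The relations a << b, that is a + b = b, for all generators a, b such that
   E a b. *)
Inductive ll_rel (G : choiceType) (E : G -> G -> Prop) :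
    {mset G} -> {mset G} -> Prop :=
| Ll_rel (a b : G) : E a b -> ll_rel E (mgen a + mgen b)%R (mgen b).

(* Main.v *)
(** Write [p_*] for the unique lower cover of [p] in J(L).  Call a finite set [F]
    of join-irreducibles a support of [x <= y] if its elements lie below [y] but
    not below [x], and every join-irreducible [p] with [p <= y \/ z] and not
    [p <= x \/ z], for some [z], is in [F] or satisfies [p D q] for some [q] in
    [F].  The sum of a support is then determined by [x <= y], since two
    supports absorb each other; a support of [x /\ y <= x] is also one of
    [y <= x \/ y]; and if [p] is minimal not below [x], then [p] alone supports
    [x <= x \/ p], so that supports exist by BCF.  Hence [Delta(x, y)] can be
    sent to the sum of a support.  The inverse sends [p] to [Delta(p_*, p)];
    only the fact that [p D q] implies [Delta(p_*, p) << Delta(q_*, q)] needs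
    join-semidistributivity. *)
Require Import Defs.
From Stdlib Require Import Relation_Operators.
From mathcomp Require Import all_boot all_order ssralg.
From mathcomp Require Import finmap multiset.
From mathcomp Require Import boolp classical_sets functions cardinality.

Set Implicit Arguments.
Unset Strict Implicit.
Unset Printing Implicit Defensive.

Import Order.TTheory GRing.Theory.

Local Open Scope mset_scope.
Local Open Scope classical_set_scope.
Local Open Scope order_scope.

(** * Extremal elements of bounded subsets of BCF posets *)

Section BoundedChainFinite.
Context d (P : porderType d).

Lemma dependent_choice_seq (T : Type) (S : T -> Prop) (R : T -> T -> Prop) :
  (exists x, S x) -> (forall x, S x -> exists2 y, S y & R x y) ->
  exists f : nat -> T, (forall n, S (f n)) /\ forall n, R (f n) (f n.+1).
Proof.
move=> [x0 Sx0] next.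
have nextP (x : {x | S x}) : {y : {x | S x} | R (sval x) (sval y)}.
  by apply: cid; case: x => x /= /next [y Sy Rxy]; exists (exist _ y Sy).
pose f := fix f n :=
  if n is m.+1 then sval (nextP (f m)) else exist _ x0 Sx0.
exists (fun n => sval (f n)); split=> n; first exact: (svalP (f n)).
exact: (svalP (nextP (f n))).
Qed.

(** Otherwise dependent choice yields an infinite [r]-chain in [S], trapped between [a] and [b].
    Taking [<] or [>] for [r] gives maximal or minimal elements. *)
Lemma BCF_extremal (r : rel P) (a b : P) (S : set P) : BCF P ->
  transitive r -> irreflexive r -> (forall x y, r x y -> x >=< y) ->
  S !=set0 -> (forall x, S x -> a <= x <= b) ->
  exists2 m, S m & forall x, S x -> ~ r m x.
Proof.
move=> bcf r_trans r_irr r_cmp S0 Sab; apply: contrapT => noext.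
have [|f [Sf rf]] := @dependent_choice_seq P S r S0.
  move=> x Sx; apply: contrapT => nx; apply: noext; exists x => // y Sy xy.
  by apply: nx; exists y.
have rfE : {homo f : m n / (m < n)%N >-> r m n}.
  by apply: homo_ltn rf => y x z; apply: r_trans.
have f_inj : injective f.
  move=> m n fmn; case: (ltngtP m n) => // /rfE; first by rewrite fmn r_irr.
  by rewrite -fmn r_irr.
have : finite_set (range f).
  apply: bcf.
  - move=> _ _ [m _ <-] [n _ <-]; apply/orP.
    case: (ltngtP m n) => [/rfE/r_cmp//|/rfE/r_cmp|->]; last by rewrite lexx.
    by rewrite comparable_sym.
  - by exists a => _ [n _ <-]; case/andP: (Sab _ (Sf n)).
  - by exists b => _ [n _ <-]; case/andP: (Sab _ (Sf n)).
have /eq_finite_set -> : (range f #= [set: nat])%card.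
  by apply: inj_card_eq => x y _ _ /f_inj.
exact: infinite_nat.
Qed.

End BoundedChainFinite.

(** * Absorption and finite sums in commutative monoids *)

Lemma absorb_addr (M : nmodType) (a b c : M) :
  (a + b = b -> a + (b + c) = b + c)%R.
Proof. by rewrite addrA => ->. Qed.

Lemma big_mset_add (M : nmodType) (G : choiceType) (h : G -> M)
    (u v : {mset G}) :
  (\sum_(g <- (u + v : {mset G})%R) h g =
   \sum_(g <- u) h g + \sum_(g <- v) h g)%R.
Proof.
rewrite -big_cat; apply: perm_big; apply/allP => x _ /=.
by rewrite count_cat !count_mem_mset msetE2.
Qed.

Lemma absorb_sum (M : nmodType) (I : eqType) (h : I -> M) (s : seq I) (b : M) :
  {in s, forall i, (h i + b = b)%R} -> (\sum_(i <- s) h i + b = b)%R.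
Proof.
elim: s => [|i s IHs] sb; first by rewrite big_nil add0r.
rewrite big_cons -addrA IHs ?sb ?mem_head // => j js.
by apply: sb; rewrite inE js orbT.
Qed.

(** * Lower covers of join-irreducibles and supports of intervals *)

Section Supports.
Context d (L : bLatticeType d) (L_bcf : BCF L).
Local Notation J := (join_irreducible L).

(** Take [u] maximal below [p]: if some [y < p] were not below [u], irreducibility would give
    [u \/ y < p], against maximality. *)
Lemma ex_lower_cover (p : J) :
  exists u, u < val p /\ forall y, y < val p -> y <= u.
Proof.
have [p_neq0 p_irr] := set_valP p.
have [|||||u u_lt u_max] :=
  @BCF_extremal _ _ <%O \bot (val p) [set y | y < val p] L_bcf.
- exact: lt_trans.
- exact: ltxx.
- by move=> x y /ltW; rewrite /Order.comparable => ->.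
- by exists \bot; rewrite /= lt0x; apply/eqP.
- by move=> x /ltW; rewrite le0x.
exists u; split=> // y y_lt; apply/negP => /negP y_nle.
have lt_uy : u < u `|` y by rewrite lt_leAnge leUl leUx lexx.
apply: (u_max (u `|` y)) => //=.
rewrite lt_neqAle leUx !ltW // !andbT; apply/eqP => /esym /p_irr [] e.
  by rewrite /= -e ltxx in u_lt.
by rewrite -e ltxx in y_lt.
Qed.

Definition lower_cover (p : J) : L := sval (cid (ex_lower_cover p)).

Lemma lower_cover_lt p : lower_cover p < val p.
Proof. exact: (svalP (cid (ex_lower_cover p))).1. Qed.

Lemma lower_cover_le p : lower_cover p <= val p.
Proof. exact/ltW/lower_cover_lt. Qed.

Lemma le_lower_cover (p : J) y : y < val p -> y <= lower_cover p.
Proof. exact: (svalP (cid (ex_lower_cover p))).2. Qed.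

Lemma meet_lower_cover (p : J) x :
  lower_cover p <= x -> ~~ (val p <= x) -> val p `&` x = lower_cover p.
Proof.
move=> px p_nle; apply/le_anti; rewrite lexI lower_cover_le px !andbT.
by apply: le_lower_cover; rewrite lt_leAnge leIl lexI lexx.
Qed.

(** A minimal [p] among the elements below [y] but not below [x] works: were [p] a join of two
    smaller elements, both would lie below [x], hence so would [p]. *)
Lemma ex_join_irreducible_minimal (x y : L) : ~~ (y <= x) ->
  exists p : J, [/\ val p <= y, ~~ (val p <= x) & lower_cover p <= x].
Proof.
move=> y_nle.
have [|||||p [p_le p_nle] p_min] :=
  @BCF_extremal _ _ >%O \bot y [set p | p <= y /\ ~~ (p <= x)] L_bcf.
- by move=> b a c /= ba cb; apply: lt_trans cb ba.
- exact: ltxx.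
- by move=> a b /ltW; rewrite /Order.comparable => ->; rewrite orbT.
- by exists y.
- by move=> p [p_le _]; rewrite le0x.
have lt_p z : z < p -> z <= x.
  move=> zp; apply/negP => /negP z_nle; apply: (p_min z) => //.
  by split=> //; apply: le_trans p_le; apply: ltW.
have p_irr : join_irreducible L p.
  split=> [p0|a b pE]; first by rewrite p0 le0x in p_nle.
  have pa : a <= p by rewrite pE leUl.
  have pb : b <= p by rewrite pE leUr.
  case: (eqVneq p a) => [->|pa']; first by left.
  case: (eqVneq p b) => [->|pb']; first by right.
  by case/negP: p_nle; rewrite pE leUx !lt_p // lt_neqAle eq_sym (pa', pb').
exists (SigSub (mem_set p_irr)); split=> //.
by apply: lt_p; apply: (lower_cover_lt (SigSub (mem_set p_irr))).
Qed.

Definition support (x y : L) (F : seq J) : Prop :=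
  [/\ uniq F, {in F, forall p, val p <= y /\ ~~ (val p <= x)} &
      forall (p : J) z, val p <= y `|` z -> ~~ (val p <= x `|` z) ->
        p \in F \/ exists2 q, q \in F & JD p q].

Lemma support_nil x : support x x [::].
Proof. by split=> // p z ->. Qed.

Lemma support_cat x y z F G : x <= y -> y <= z ->
  support x y F -> support y z G -> support x z (F ++ G).
Proof.
move=> xy yz [uF F1 F2] [uG G1 G2]; split.
- rewrite cat_uniq uF uG andbT; apply/hasPn => p /G1 [_ p_nle].
  by apply: contra p_nle => /F1 [].
- move=> p; rewrite mem_cat => /orP[/F1|/G1] [p_le p_nle]; split=> //.
    exact: le_trans yz.
  by apply: contra p_nle => /le_trans; apply.
- move=> p t p_le p_nle; rewrite mem_cat.
  case: (boolP (val p <= y `|` t)) => [p_le'|p_nle'].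
    have [->|[q qF pq]] := F2 p t p_le' p_nle; first by left.
    by right; exists q; rewrite // mem_cat qF.
  have [->|[q qG pq]] := G2 p t p_le p_nle'; first by left; rewrite orbT.
  by right; exists q; rewrite // mem_cat qG orbT.
Qed.

Lemma support1 x (p : J) : lower_cover p <= x -> ~~ (val p <= x) ->
  support x (x `|` val p) [:: p].
Proof.
move=> px p_nle; split=> //.
  by move=> q; rewrite inE => /eqP ->; rewrite leUr.
move=> q z q_le q_nle; rewrite inE.
have [->|qp] := eqVneq q p; first by left.
right; exists p; rewrite ?inE //; split.
  by move=> /val_inj /eqP; apply/negP.
(* Adding [x] to the witness makes every [y < p] vanish from the join, since [y <= p_* <= x]. *)
exists (x `|` z); rewrite joinA [val p `|` x]joinC; split=> // y y_lt.
have yx : y <= x by apply: le_trans px; apply: le_lower_cover.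
by rewrite joinA (join_r yx); apply/negP.
Qed.

Lemma support_transpose x y F : support (x `&` y) x F -> support y (x `|` y) F.
Proof.
move=> [uF F1 F2]; split=> // [p /F1 [p_le]|p z p_le p_nle].
  by rewrite lexI p_le /= => ->; rewrite lexUl.
(* With [y \/ z] in place of [z], the lower end [x /\ y] is absorbed by [y]. *)
apply: (F2 p (y `|` z)); first by rewrite joinA.
by rewrite joinA (join_r (leIr y x)).
Qed.

(** Both sums equal the sum over the union of [F] and [G], written [U F G] or [U G F]: each term of
    one support outside the other is absorbed by a term of the other. *)
Lemma support_sum (M : nmodType) (h : J -> M) x y F G :
  (forall p q, JD p q -> (h p + h q = h q)%R) ->
  support x y F -> support x y G -> (\sum_(p <- F) h p = \sum_(p <- G) h p)%R.
Proof.
move=> hD.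
pose U A B : M := (\sum_(p <- [seq p <- A | p \notin B]) h p +
                   \sum_(p <- B) h p)%R.
have absorbed A B : support x y A -> support x y B ->
    U A B = (\sum_(p <- B) h p)%R.
  move=> [_ A1 _] [_ _ B2]; apply: absorb_sum => p.
  rewrite mem_filter => /andP[pB /A1 [p_le p_nle]].
  (* Taking [z] to be [\bot] shows that the last clause of [support] applies to every element of
     [A]. *)
  have [||pB'|[q qB pq]] := B2 p \bot; rewrite ?joinx0 //.
    by rewrite pB' in pB.
  by rewrite (big_rem q) //= addrA hD.
have UC A B : uniq A -> uniq B -> U A B = U B A.
  move=> uA uB; rewrite /U -!big_cat; apply/perm_big/uniq_perm.
  - rewrite cat_uniq filter_uniq // uB andbT; apply/hasPn => p pB.
    by rewrite mem_filter pB.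
  - rewrite cat_uniq filter_uniq // uA andbT; apply/hasPn => p pA.
    by rewrite mem_filter pA.
  - move=> p; rewrite !mem_cat !mem_filter.
    by case: (p \in A); case: (p \in B).
move=> sF sG; rewrite -(absorbed _ _ sF sG) -(absorbed _ _ sG sF).
by case: sF sG => uF _ _ [uG _ _]; apply: UC.
Qed.

End Supports.

(** * Interval calculus in the dimension monoid *)

Section DimensionClasses.
Context d (L : latticeType d).

(* The class of Delta(x /\ y, y): a total function of x and y, equal to the
   generator Delta(x, y) when x <= y. *)
Definition dim (x y : L) : Dim L :=
  pm_class (@Dim_rel d L) (Delta (leIr y x)).

Lemma pm_class_Delta (x y : L) (xy : x <= y) :
  pm_class (@Dim_rel d L) (Delta xy) = dim x y.
Proof.
congr (pm_class _ (mgen _)); apply: val_inj => /=.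
by rewrite (meet_l xy).
Qed.

Lemma dimxx x : dim x x = 0%R.
Proof.
rewrite -(pm_class_Delta (lexx x)).
by apply/pm_classP/congr_rel/Dim_rel0.
Qed.

Lemma dim_add x y z :
  x <= y -> y <= z -> (dim x y + dim y z = dim x z)%R.
Proof.
move=> xy yz; rewrite -(pm_class_Delta xy) -(pm_class_Delta yz) -pm_classD.
rewrite -(pm_class_Delta (le_trans xy yz)); apply/esym/pm_classP.
exact/congr_rel/Dim_relD.
Qed.

Lemma dim_transpose x y : dim (x `&` y) x = dim y (x `|` y).
Proof.
rewrite -(pm_class_Delta (leIl x y)) -(pm_class_Delta (leUr y x)).
exact/pm_classP/congr_rel/Dim_relIU.
Qed.

End DimensionClasses.

(** * The absorption relations in the dimension monoid, and the isomorphism *)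

Section Isomorphism.
Context d (L : bLatticeType d).
Context (L_bcf : BCF L) (L_jsd : join_semidistributive L).
Local Notation J := (join_irreducible L).
Local Notation lower_cover := (lower_cover L_bcf).
Local Notation support := (@support d L).

Definition dim_irr (p : J) : Dim L := dim (lower_cover p) (val p).

Lemma dim_irrE (p : J) x : lower_cover p <= x -> ~~ (val p <= x) ->
  dim_irr p = dim x (x `|` val p).
Proof.
by move=> px p_nle; rewrite joinC -dim_transpose meet_lower_cover.
Qed.

Lemma dim_irr_JD (p q : J) : JD p q -> (dim_irr p + dim_irr q = dim_irr q)%R.
Proof.
case=> pq [x0 [p_le0 p_nle0]].
(* Joining the witness with [q_*] keeps [p] out of reach, by the instance [y = q_*] of the
   definition of D. *)
pose x := lower_cover q `|` x0.
have qx : lower_cover q <= x by rewrite leUl.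
have {p_le0} p_le : val p <= val q `|` x.
  by rewrite joinA (join_l (lower_cover_le L_bcf q)).
have {p_nle0} p_nle : ~~ (val p <= x).
  exact/negP/p_nle0/lower_cover_lt.
move: {x0} x qx p_le p_nle => x0 qx0 p_le0 p_nle0.
(* If [p] is not below [x0 \/ p_*], enlarge [x0] by [p_*]; otherwise keep [x0]. *)
have {x0 qx0 p_le0 p_nle0} [x [qx p_le p_nle p_cover]] : exists x,
    [/\ lower_cover q <= x, val p <= val q `|` x, ~~ (val p <= x) &
        lower_cover p <= x \/ val p <= x `|` lower_cover p].
  case: (boolP (val p <= x0 `|` lower_cover p)) => p_cover.
    by exists x0; split=> //; right.
  exists (x0 `|` lower_cover p); split=> //; last by left; rewrite leUr.
    by apply: le_trans qx0 _; rewrite leUl.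
  by apply: le_trans p_le0 _; rewrite leU2 ?leUl.
have q_nle : ~~ (val q <= x) by apply: contra p_nle => /join_r <-.
have xpq : x `|` val p <= x `|` val q by rewrite leUx leUl joinC.
have qE : dim_irr q = (dim x (x `|` val p) + dim (x `|` val p) (x `|` val q))%R.
  by rewrite (dim_irrE qx q_nle) (dim_add (leUl x (val p)) xpq).
case: p_cover => [px|p_cover].
(* If [q <= x \/ p], semidistributivity gives [x \/ p = x \/ (p /\ q)]. Since [p <> q], the meet
   lies below [p_*] or [q_*], hence below [x], forcing [p <= x]. *)
- have q_nle' : ~~ (val q <= x `|` val p).
    apply/negP => q_le.
    have /L_jsd e : x `|` val p = x `|` val q.
      by apply/le_anti; rewrite xpq leUx leUl.
    have pq_lex : val p `&` val q <= x.
      have [/meet_idPl pq_le|pq_neq] := eqVneq (val p `&` val q) (val p).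
        apply: le_trans (leIl _ _) (le_trans _ qx); apply: le_lower_cover.
        by rewrite lt_neqAle pq_le andbT; apply/eqP.
      apply: le_trans px; apply: le_lower_cover.
      by rewrite lt_neqAle pq_neq leIl.
    by case/negP: p_nle; rewrite -(join_l pq_lex) -e leUr.
  have qp : lower_cover q <= x `|` val p by apply: le_trans qx (leUl _ _).
  (* The two summands of [qE] are now the classes of [p] and of [q] itself. *)
  rewrite [RHS]qE (dim_irrE px p_nle) (dim_irrE qp q_nle').
  by rewrite joinAC [X in dim (x `|` val p) X]join_l // joinC.
(* With u = p /\ x, both [u, p_*] and [u, p] transpose up to [x, x \/ p]. *)
- have xp : x `|` lower_cover p = x `|` val p.
    by apply/le_anti; rewrite leU2 ?lower_cover_le //= leUx leUl p_cover.
  have e : dim x (x `|` val p) = (dim x (x `|` val p) + dim_irr p)%R.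
    have px_le : val p `&` x <= lower_cover p.
      by apply: le_lower_cover; rewrite lt_leAnge leIl lexI lexx.
    rewrite {1}joinC -dim_transpose -(dim_add px_le (lower_cover_le L_bcf p)).
    rewrite -xp [X in dim x X]joinC -dim_transpose.
    have -> : lower_cover p `&` x = val p `&` x.
      by apply/le_anti; rewrite leI2 ?lower_cover_le //= lexI px_le leIr.
    exact: erefl.
  rewrite qE; apply: absorb_addr; rewrite addrC; exact/esym.
Qed.

Lemma dim_irr_JD_trans (p q : J) :
  JD_trans p q -> (dim_irr p + dim_irr q = dim_irr q)%R.
Proof.
elim=> {p q} [p q /dim_irr_JD //|p q r _ pq _ qr].
by rewrite -qr; apply: absorb_addr.
Qed.

(** Among the lower ends that fail, take a maximal [z]. A minimal [p] not below [z] leads up to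
    [z \/ p], which succeeds, and prepending [p] to its support serves [z]. *)
Lemma ex_support x y : x <= y ->
  exists2 F, support x y F & dim x y = (\sum_(p <- F) dim_irr p)%R.
Proof.
move=> xy; apply: contrapT => noF.
pose good z := exists2 F, support z y F & dim z y = (\sum_(p <- F) dim_irr p)%R.
have [|||||z [zy z_bad] z_max] :=
  @BCF_extremal _ _ <%O \bot y [set z | z <= y /\ ~ good z] L_bcf.
- exact: lt_trans.
- exact: ltxx.
- by move=> a b /ltW; rewrite /Order.comparable => ->.
- by exists x.
- by move=> z [zy _]; rewrite le0x.
have [ezy|neq_zy] := eqVneq z y.
  apply: z_bad; exists [::]; first by rewrite ezy; apply: support_nil.
  by rewrite ezy dimxx big_nil.
have [|p [p_le p_nle pz]] := @ex_join_irreducible_minimal _ _ L_bcf z y.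
  by move: neq_zy; rewrite eq_le zy.
have zpy : z `|` val p <= y by rewrite leUx zy.
have lt_z : z < z `|` val p.
  by rewrite lt_leAnge leUl leUx lexx.
have [F sF dF] : good (z `|` val p).
  by apply: contrapT => bad; apply: (z_max (z `|` val p)).
apply: z_bad; exists ([:: p] ++ F).
  by apply: support_cat (support1 pz p_nle) sF; rewrite ?leUl.
by rewrite big_cons -dF (dim_irrE pz p_nle) dim_add ?leUl.
Qed.

(** Letting [E] range between D and its transitive closure treats both presentations at once: the
    first inclusion makes [f] well defined, the second makes [g] well defined. *)
Lemma Dim_isomorphic (E : J -> J -> Prop) :
  (forall p q, JD p q -> E p q) -> (forall p q, E p q -> JD_trans p q) ->
  monoid_isomorphic (Dim L) (presented_monoid (ll_rel E)).
Proof.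
move=> JD_E E_JD.
pose M := presented_monoid (ll_rel E).
pose bar (p : J) : M := pm_class (ll_rel E) (mgen p).
have bar_JD p q : JD p q -> (bar p + bar q = bar q)%R.
  move=> /JD_E pq; rewrite -pm_classD; apply/pm_classP.
  exact/congr_rel/Ll_rel.
(* The chosen support also computes the class of the interval, which later makes [g \o f] the
   identity on generators. *)
pose F (xy : interval_of L) := s2val (cid2 (ex_support (svalP xy))).
have sF xy : support (sval xy).1 (sval xy).2 (F xy).
  exact: (s2valP (cid2 (ex_support (svalP xy)))).
have dF xy : dim (sval xy).1 (sval xy).2 = (\sum_(p <- F xy) dim_irr p)%R.
  exact: (s2valP' (cid2 (ex_support (svalP xy)))).
pose h xy := (\sum_(p <- F xy) bar p)%R.
have hE xy G :
    support (sval xy).1 (sval xy).2 G -> h xy = (\sum_(p <- G) bar p)%R.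
  exact: support_sum bar_JD (sF xy).
have [|f f_Delta] := @pm_lift _ (@Dim_rel d L) M h.
  move=> _ _ [x|x y z xy yz|x y].
  - rewrite big_mset0 /Delta big_msetn.
    by rewrite (hE _ [::]) ?big_nil //; apply: support_nil.
  - rewrite big_mset_add /Delta !big_msetn /h -big_cat.
    apply: (hE _ (_ ++ _)).
    exact: support_cat xy yz (sF (exist _ (x, y) xy)) (sF (exist _ (y, z) yz)).
  - rewrite /Delta !big_msetn; apply/esym/hE/support_transpose.
    exact: (sF (exist _ (x `&` y, x) _)).
have [|g g_bar] := @pm_lift _ (ll_rel E) (Dim L) dim_irr.
  move=> _ _ [p q /E_JD pq]; rewrite big_mset_add !big_msetn.
  exact: dim_irr_JD_trans.
exists f; exists g.
  apply: (@pm_lift_unique _ (@Dim_rel d L) _ (g \o f) idfun) => -[[x y] xy] /=.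
  rewrite f_Delta raddf_sum (eq_bigr _ (fun p _ => g_bar p)) -dF.
  exact/esym/pm_class_Delta.
apply: (@pm_lift_unique _ (ll_rel E) _ (f \o g) idfun) => p /=.
rewrite g_bar /dim_irr -(pm_class_Delta (lower_cover_le L_bcf p)) f_Delta.
(* By [hE] the chosen support of [[p_*, p]] may be replaced by [p] alone. *)
rewrite (hE _ [:: p]) ?big_seq1 //=.
rewrite -[in val p](join_r (lower_cover_le L_bcf p)).
by apply: support1; rewrite // lt_geF ?lower_cover_lt.
Qed.

End Isomorphism.

Theorem corollary4p5 (d : Order.disp_t) (L : bLatticeType d)
    (L_bcf : BCF L) (L_jsd : join_semidistributive L) :
  monoid_isomorphic (Dim L)
    (@presented_monoid (join_irreducible L) (ll_rel (@JD d L))) /\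
  monoid_isomorphic (Dim L)
    (@presented_monoid (join_irreducible L) (ll_rel (@JD_trans d L))).
Proof.
by split; apply: (Dim_isomorphic L_bcf L_jsd) => p q //; apply: t_step.
Qed.
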